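(* Let $\mathbb{K}$ be either $\mathbb{Z}$ or $\mathbb{R}$. Let $\mathcal{A},\mathcal{B}$ be $\overline{\mathbb{K}}$-categories and let $\mathbf{D},\mathbf{E}$ be $\overline{\mathbb{K}}$-extended L-convex sets. Then: (i) the map $[-,\overline{\mathbb{K}}]:[\mathcal{A},\mathcal{B}]_0\to[\![\,[\mathcal{B},\overline{\mathbb{K}}],[\mathcal{A},\overline{\mathbb{K}}]\,]\!]_0$, $F\mapsto[F,\overline{\mathbb{K}}]$, is bijective; (ii) the map $[\![-,\overline{\mathbb{K}}]\!]:[\![\mathbf{D},\mathbf{E}]\!]_0\to[\,[\![\mathbf{E},\overline{\mathbb{K}}]\!],[\![\mathbf{D},\overline{\mathbb{K}}]\!]\,]_0$, $\Phi\mapsto[\![\Phi,\overline{\mathbb{K}}]\!]$, is bijective.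
   Context: **Extended arithmetic.** $\mathbb{K}$ denotes either $\mathbb{Z}$ or $\mathbb{R}$. On $\mathbb{K}\cup\{-\infty,\infty\}$ use the usual total order, with $-\infty$ least and $\infty$ greatest; $\sup$ and $\inf$ are with respect to it, so $\sup\emptyset=-\infty$ and $\inf\emptyset=\infty$. Addition extends that of $\mathbb{K}$: $x+y=\infty$ if $x=\infty$ or $y=\infty$; otherwise $x+y=-\infty$ if $x=-\infty$ or $y=-\infty$. Subtraction extends that of $\mathbb{K}$: $y-x=-\infty$ if $x=\infty$ or $y=-\infty$; otherwise $y-x=\infty$ if $y=\infty$ or $x=-\infty$. (In particular $\infty-\infty=-\infty$ and $(-\infty)-(-\infty)=-\infty$.) **$\overline{\mathbb{K}}$-categories.** A $\overline{\mathbb{K}}$-category $\mathcal{A}$ is a pair $(\mathrm{Ob}(\mathcal{A}),d_{\mathcal{A}})$ of a set and a map $d_{\mathcal{A}}:\mathrm{Ob}(\mathcal{A})\times\mathrm{Ob}(\mathcal{A})\to\mathbb{K}\cup\{-\infty,\infty\}$ with $d_{\mathcal{A}}(a,b)+d_{\mathcal{A}}(b,c)\ge d_{\mathcal{A}}(a,c)$ and $0\ge d_{\mathcal{A}}(a,a)$ for all $a,b,c$. A $\overline{\mathbb{K}}$-functor (nonexpansive map) $F:\mathcal{A}\to\mathcal{B}$ is a map $\mathrm{Ob}(F):\mathrm{Ob}(\mathcal{A})\to\mathrm{Ob}(\mathcal{B})$ with $d_{\mathcal{A}}(a,a')\ge d_{\mathcal{B}}(F(a),F(a'))$ for all $a,a'$.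 $[\mathcal{A},\mathcal{B}]_0$ is the set of all $\overline{\mathbb{K}}$-functors $\mathcal{A}\to\mathcal{B}$. $\overline{\mathbb{K}}$ itself is the $\overline{\mathbb{K}}$-category with set of objects $\mathbb{K}\cup\{-\infty,\infty\}$ and $d_{\overline{\mathbb{K}}}(x,y)=y-x$. **$\overline{\mathbb{K}}$-extended L-convex sets.** A $\overline{\mathbb{K}}$-extended L-convex set $\mathbf{D}$ is a pair $(\mathrm{Ind}(\mathbf{D}),\mathbf{D}_0)$ of a (possibly infinite) set $\mathrm{Ind}(\mathbf{D})$ and a subset $\mathbf{D}_0$ of the set $\overline{\mathbb{K}}^{\mathrm{Ind}(\mathbf{D})}$ of all maps $\mathrm{Ind}(\mathbf{D})\to\mathbb{K}\cup\{-\infty,\infty\}$ such that: (order completeness) for every subset $S\subseteq\mathbf{D}_0$ (including $S=\emptyset$), the coordinate-wise $\inf$ and the coordinate-wise $\sup$ of $S$ belong to $\mathbf{D}_0$; (weight completeness) $p+\alpha\cdot\mathbf{1}\in\mathbf{D}_0$ for all $p\in\mathbf{D}_0$ and $\alpha\in\mathbb{K}\cup\{-\infty,\infty\}$, where $(p+\alpha\cdot\mathbf{1})(v)=p(v)+\alpha$. A homomorphism $\Phi:\mathbf{D}\to\mathbf{E}$ is a map $\mathrm{Ind}(\Phi):\mathrm{Ind}(\mathbf{E})\to\mathrm{Ind}(\mathbf{D})$ such that $\Phi_0(p):=p\circ\mathrm{Ind}(\Phi)\in\mathbf{E}_0$ for all $p\in\mathbf{D}_0$; two homomorphisms are equal iff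 their maps $\mathrm{Ind}$ are equal. $[\![\mathbf{D},\mathbf{E}]\!]_0$ is the set of all homomorphisms $\mathbf{D}\to\mathbf{E}$. $\overline{\mathbb{K}}$ itself is also regarded as the $\overline{\mathbb{K}}$-extended L-convex set $(\{\ast\},\mathbb{K}\cup\{-\infty,\infty\})$, identifying $\mathbb{K}\cup\{-\infty,\infty\}$ with $\overline{\mathbb{K}}^{\{\ast\}}$. **Constructions on objects.** For a $\overline{\mathbb{K}}$-category $\mathcal{A}$, $[\mathcal{A},\overline{\mathbb{K}}]$ is the $\overline{\mathbb{K}}$-extended L-convex set $(\mathrm{Ob}(\mathcal{A}),[\mathcal{A},\overline{\mathbb{K}}]_0)$, where $[\mathcal{A},\overline{\mathbb{K}}]_0\subseteq\overline{\mathbb{K}}^{\mathrm{Ob}(\mathcal{A})}$ is the set of all $\overline{\mathbb{K}}$-functors $\mathcal{A}\to\overline{\mathbb{K}}$. For a $\overline{\mathbb{K}}$-extended L-convex set $\mathbf{D}$, $[\![\mathbf{D},\overline{\mathbb{K}}]\!]$ is the $\overline{\mathbb{K}}$-category whose set of objects $[\![\mathbf{D},\overline{\mathbb{K}}]\!]_0$ is the set of all homomorphisms $\mathbf{D}\to\overline{\mathbb{K}}$, with distance $d(\Phi,\Psi)=\sup_{p\in\mathbf{D}_0}\{\Psi_0(p)-\Phi_0(p)\}$. There is a bijection $\pi_{\mathbf{D}}:\mathrm{Ind}(\mathbf{D})\to[\![\mathbf{D},\overline{\mathbb{K}}]\!]_0$, $v\mapsto\pi_v$, where $\mathrm{Ind}(\pi_v)(\ast)=v$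 (so $(\pi_v)_0(p)=p(v)$). **Constructions on maps.** For a $\overline{\mathbb{K}}$-functor $F:\mathcal{A}\to\mathcal{B}$, $[F,\overline{\mathbb{K}}]:[\mathcal{B},\overline{\mathbb{K}}]\to[\mathcal{A},\overline{\mathbb{K}}]$ is the homomorphism with $\mathrm{Ind}([F,\overline{\mathbb{K}}])=\mathrm{Ob}(F)$. For a homomorphism $\Phi:\mathbf{D}\to\mathbf{E}$, $[\![\Phi,\overline{\mathbb{K}}]\!]:[\![\mathbf{E},\overline{\mathbb{K}}]\!]\to[\![\mathbf{D},\overline{\mathbb{K}}]\!]$ is the $\overline{\mathbb{K}}$-functor with $\mathrm{Ob}([\![\Phi,\overline{\mathbb{K}}]\!])=\pi_{\mathbf{D}}\circ\mathrm{Ind}(\Phi)\circ\pi_{\mathbf{E}}^{-1}$, i.e. $\pi_w\mapsto\pi_{\mathrm{Ind}(\Phi)(w)}$. *)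

(* Defs.v *)
From mathcomp Require Import all_boot all_order all_algebra.
From mathcomp Require Import boolp classical_sets reals constructive_ereal ereal.

Set Implicit Arguments.
Unset Strict Implicit.
Unset Printing Implicit Defensive.
Import Order.TTheory GRing.Theory Num.Theory DualAddTheory.
Local Open Scope classical_set_scope.
Local Open Scope ereal_scope.

Variant int_or_real : realDomainType -> Prop :=
| IsInt : int_or_real int
| IsReal (R : realType) : int_or_real R.

Record scalars := Scalars {
  scalar_dom :> realDomainType;
  scalarsP : int_or_real scalar_dom }.

(* In [\bar K], [(x + y)%dE] is the addition in which [+oo] absorbs [-oo],
   whereas in [(y - x)%E], i.e. [y + (- x)], it is [-oo] that absorbs [+oo]:
   these are the two conventions needed, and they are adjoint (lemma
   [lee_subl_dadd] below).  The suprema and infima are those of the order on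
   [\bar K], since [ereal_sup] is not available for [K = int]. *)
Notation ksup := (@supremum _ (\bar _) -oo).
Notation kinf := (@infimum _ (\bar _) +oo).

Section ExtendedScalars.
Variable K : scalars.
Implicit Types (x y z : \bar K) (S : set (\bar K)).

Lemma daddE_spec x y : (x + y)%dE =
  match x, y with
  | +oo, _ | _, +oo => +oo
  | -oo, _ | _, -oo => -oo
  | r%:E, s%:E => (r + s)%:E
  end.
Proof. by case: x => [r||]; case: y => [s||]. Qed.

Lemma subE_spec x y : y - x =
  match x, y with
  | +oo, _ | _, -oo => -oo
  | -oo, _ | _, +oo => +oo
  | r%:E, s%:E => (s - r)%:E
  end.
Proof. by case: x => [r||]; case: y => [s||]. Qed.

Lemma lee_subl_dadd x y z : (y - x <= z) = (y <= (x + z)%dE).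
Proof.
rewrite daddE_spec subE_spec.
case: x => [r||]; case: y => [s||]; case: z => [t||];
  rewrite ?leey ?leNye ?lee_fin //.
by rewrite lerBlDl.
Qed.

Lemma dlee_add x x' y y' : x <= x' -> y <= y' -> ((x + y)%dE <= (x' + y')%dE).
Proof.
rewrite !daddE_spec.
case: x => [r||]; case: x' => [r'||]; case: y => [s||]; case: y' => [s'||];
  rewrite ?leey ?leNye ?lee_fin //.
exact: lerD.
Qed.

Lemma sube_triangle x y z : z - x <= ((y - x)%E + (z - y)%E)%dE.
Proof.
rewrite daddE_spec !subE_spec.
case: x => [r||]; case: y => [s||]; case: z => [t||];
  rewrite ?leey ?leNye ?lee_fin //.
by rewrite [leRHS]addrC subrKA.
Qed.

Lemma sube_self_le0 x : x - x <= 0.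
Proof. by case: x => [r||]; rewrite ?leNye // subE_spec lee_fin subrr. Qed.

Lemma sube_dadd2r x y z : (y + z)%dE - (x + z)%dE <= y - x.
Proof.
rewrite lee_subl_dadd !daddE_spec !subE_spec.
case: x => [r||]; case: y => [s||]; case: z => [t||];
  rewrite ?leey ?leNye ?lee_fin //.
by rewrite [leRHS]addrC subrKA.
Qed.

Lemma supremums_ex S : supremums S !=set0.
Proof.
case: K S => _ [S|R S]; last exact: ereal_supremums_neq0.
have [Soo|nSoo] := pselect (S +oo).
  exists +oo; split => [x _|x]; [exact: leey|exact].
have [[a Sa]|nS] := pselect (exists a : int, S a%:E); last first.
  exists -oo; split => [x Sx|x _]; last exact: leNye.
  by case: x Sx => [r Sr||]//; case: nS; exists r.
have [[b Sb]|nb] := pselect (exists b : int, ubound S b%:E); last first.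
  exists +oo; split => [x _|x ubx]; first exact: leey.
  case: x ubx => [r ubr||ub]; [by case: nb; exists r|by []|].
  by have := ub _ Sa.
pose P n := `[< S (b - Posz n)%:E >].
have exP : exists n, P n.
  have : (a <= b)%R by have := Sb _ Sa; rewrite lee_fin.
  rewrite -subr_ge0 => /gez0_abs h; exists `|b - a|%N.
  by apply/asboolP; rewrite h opprB addrC subrK.
case: (ex_minnP exP) => n /asboolP Sn min.
exists (b - Posz n)%:E; split => [x Sx|x]; last exact.
case: x Sx => [r Sr||_]//; last exact: leNye.
have : (r <= b)%R by have := Sb _ Sr; rewrite lee_fin.
rewrite -subr_ge0 => /gez0_abs h.
rewrite lee_fin lerBrDl -lerBrDr -h lez_nat; apply: min.
by apply/asboolP; rewrite h opprB addrC subrK.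
Qed.

Lemma infimums_ex S : infimums S !=set0.
Proof.
have [x [ubx lbx]] := supremums_ex (lbound S).
by exists x; split => // y Sy; apply: lbx => z; apply.
Qed.

Lemma ksup_supremums S : supremums S (ksup S).
Proof.
rewrite /supremum; case: ifPn => [/eqP ->|_].
  by split => [x []|x _]; exact: leNye.
by case: xgetP => [_ ->//|n]; have [x /n] := supremums_ex S.
Qed.

Lemma kinf_infimums S : infimums S (kinf S).
Proof.
rewrite /infimum; case: ifPn => [/eqP ->|_].
  by split => [x []|x _]; exact: leey.
by case: xgetP => [_ ->//|n]; have [x /n] := infimums_ex S.
Qed.

End ExtendedScalars.

Record kcat (K : scalars) := KCat {
  ob :> Type;
  dist : ob -> ob -> \bar K;
  dist_triangle : forall a b c, dist a c <= (dist a b + dist b c)%dE;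
  dist_self : forall a, dist a a <= 0 }.

Definition nonexpansive (K : scalars) (A B : kcat K) (f : A -> B) : Prop :=
  forall a a' : A, dist (f a) (f a') <= dist a a'.

Record kfunctor (K : scalars) (A B : kcat K) := KFunctor {
  fun_ob :> A -> B;
  fun_obP : nonexpansive fun_ob }.

Definition kbar_cat (K : scalars) : kcat K :=
  @KCat K (\bar K) (fun x y => y - x)
    (fun x y z => sube_triangle x y z) (@sube_self_le0 K).

Record lset (K : scalars) := LSet {
  ind : Type;
  pts : set (ind -> \bar K);
  pts_inf : forall S : set (ind -> \bar K), S `<=` pts ->
    pts (fun v => kinf [set p v | p in S]);
  pts_sup : forall S : set (ind -> \bar K), S `<=` pts ->
    pts (fun v => ksup [set p v | p in S]);
  pts_shift : forall (p : ind -> \bar K) (alpha : \bar K), pts p ->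
    pts (fun v => (p v + alpha)%dE) }.

Record lhom (K : scalars) (D E : lset K) := LHom {
  hom_ind : ind E -> ind D;
  hom_indP : forall p : ind D -> \bar K, pts p -> pts (p \o hom_ind) }.

Definition hom_pt (K : scalars) (D E : lset K) (Phi : lhom D E)
  (p : ind D -> \bar K) : ind E -> \bar K := p \o hom_ind Phi.

(* Functions [unit -> \bar K] stand for elements of \bar K. *)
Definition kbar_lset (K : scalars) : lset K :=
  @LSet K unit setT (fun _ _ => I) (fun _ _ => I) (fun _ _ _ => I).

Section Extensionality.
Variable K : scalars.

Lemma kfunctor_eq (A B : kcat K) (F G : kfunctor A B) :
  fun_ob F = fun_ob G -> F = G.
Proof.
case: F G => [f fP] [g gP] /= fg; case: _ / fg gP => gP.
by congr KFunctor; exact: Prop_irrelevance.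
Qed.

Lemma lhom_eq (D E : lset K) (Phi Psi : lhom D E) :
  hom_ind Phi = hom_ind Psi -> Phi = Psi.
Proof.
case: Phi Psi => [f fP] [g gP] /= fg; case: _ / fg gP => gP.
by congr LHom; exact: Prop_irrelevance.
Qed.

End Extensionality.

Section Presheaves.
Variables (K : scalars) (A : kcat K).

Definition presheaf_pts : set (A -> \bar K) :=
  [set p | @nonexpansive K A (kbar_cat K) p].

Lemma presheaf_inf (S : set (A -> \bar K)) : S `<=` presheaf_pts ->
  presheaf_pts (fun v => kinf [set p v | p in S]).
Proof.
move=> SP a a' /=; rewrite lee_subl_dadd daddeC -lee_subl_dadd.
apply: (kinf_infimums _).2 => _ [p Sp <-].
rewrite lee_subl_dadd daddeC.
apply: (@le_trans _ _ (p a')).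
  by apply: (kinf_infimums _).1; exists p.
by rewrite -lee_subl_dadd; exact: SP.
Qed.

Lemma presheaf_sup (S : set (A -> \bar K)) : S `<=` presheaf_pts ->
  presheaf_pts (fun v => ksup [set p v | p in S]).
Proof.
move=> SP a a' /=; rewrite lee_subl_dadd.
apply: (ksup_supremums _).2 => _ [p Sp <-].
apply: (@le_trans _ _ (p a + dist a a')%dE).
  by rewrite -lee_subl_dadd; exact: SP.
by apply: dlee_add => //; apply: (ksup_supremums _).1; exists p.
Qed.

Lemma presheaf_shift (p : A -> \bar K) (alpha : \bar K) :
  presheaf_pts p -> presheaf_pts (fun v => (p v + alpha)%dE).
Proof.
by move=> pP a a'; apply: le_trans (pP a a'); exact: sube_dadd2r.
Qed.

(* The L-convex set [A, \bar K] of all functors from A to \bar K. *)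
Definition presheaf : lset K :=
  LSet presheaf_inf presheaf_sup presheaf_shift.

End Presheaves.

Section Evaluations.
Variables (K : scalars) (D : lset K).

Definition eval_dist (Phi Psi : lhom D (kbar_lset K)) : \bar K :=
  ksup [set hom_pt Psi p tt - hom_pt Phi p tt | p in @pts K D].

Lemma eval_dist_triangle Phi Psi Xi :
  eval_dist Phi Xi <= (eval_dist Phi Psi + eval_dist Psi Xi)%dE.
Proof.
apply: (ksup_supremums _).2 => _ [p Dp <-].
apply: le_trans (sube_triangle _ (hom_pt Psi p tt) _) _.
by apply: dlee_add; apply: (ksup_supremums _).1; exists p.
Qed.

Lemma eval_dist_self Phi : eval_dist Phi Phi <= 0.
Proof.
by apply: (ksup_supremums _).2 => _ [p Dp <-]; exact: sube_self_le0.
Qed.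

(* The category [[D, \bar K]] of all homomorphisms from D to \bar K; [proj v]
   below is the evaluation pi_v : p |-> p v. *)
Definition dual_cat : kcat K := KCat eval_dist_triangle eval_dist_self.

Definition proj (v : ind D) : dual_cat :=
  @LHom K D (kbar_lset K) (fun=> v) (fun _ _ => I).

Definition proj_inv (Phi : dual_cat) : ind D := hom_ind Phi tt.

Lemma projK : cancel proj proj_inv. Proof. by []. Qed.

Lemma proj_invK : cancel proj_inv proj.
Proof. by move=> Phi; apply: lhom_eq; apply/funext => -[]. Qed.

End Evaluations.

Section Maps.
Variable K : scalars.

Lemma precomp_pts (A B : kcat K) (F : kfunctor A B) (p : B -> \bar K) :
  presheaf_pts p -> presheaf_pts (p \o F).
Proof. by move=> pP a a'; apply: le_trans (pP _ _) (fun_obP F a a'). Qed.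

Definition presheaf_map (A B : kcat K) (F : kfunctor A B) :
    lhom (presheaf B) (presheaf A) :=
  @LHom K (presheaf B) (presheaf A) (fun_ob F) (@precomp_pts A B F).

Definition dual_map_ob (D E : lset K) (Phi : lhom D E) :
    dual_cat E -> dual_cat D :=
  @proj K D \o hom_ind Phi \o @proj_inv K E.

Lemma dual_map_nonexpansive (D E : lset K) (Phi : lhom D E) :
  nonexpansive (dual_map_ob Phi).
Proof.
move=> X Y; apply: (ksup_supremums _).2 => _ [p Dp <-].
by apply: (ksup_supremums _).1; exists (hom_pt Phi p) => //; exact: hom_indP.
Qed.

Definition dual_map (D E : lset K) (Phi : lhom D E) :
    kfunctor (dual_cat E) (dual_cat D) :=
  KFunctor (dual_map_nonexpansive Phi).

End Maps.

(* Main.v *)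
Require Import Defs.
From mathcomp Require Import ssreflect ssrfun.
From mathcomp Require Import all_boot order ssralg ssrnum.
From mathcomp Require Import boolp classical_sets constructive_ereal.

(** Both maps only repackage an underlying function: a functor [F] and the
    homomorphism [presheaf_map F] have the same one, and so have [Phi] and
    [dual_map Phi], up to the bijections [proj].  Injectivity is therefore
    immediate, and surjectivity says that each of the two conditions on a
    function implies the other.

    For (i), let precomposition with [f : A -> B] send presheaves to presheaves.
    Applied to the representable presheaf [dist (f a)], this bounds
    [dist (f a) (f a')] by [dist (f a) (f a) + dist a a'], hence by
    [dist a a'] ([nonexpansive_of_precomp]).

    For (ii), a functor between the duals makes [p \o f] a presheaf on
    [dual_cat E] for every point [p] of [D], so it is enough that the points of
    [E] include all presheaves on [dual_cat E] ([pts_of_presheaf]).  By the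
    Yoneda formula, a presheaf [q] is the infimum over [v] of the functions
    [d(v, -) + q v], where [d] is the distance of [dual_cat E]; thus order and
    weight completeness reduce the claim to the representables [d(v, -)]
    ([pts_dist]).  Each of these is the supremum of the functions [r - r v] over
    the points [r].  The subtraction of an infinite [r v] is not a shift, but
    subtracting any [x] is the supremum of the shifts by those [alpha] for
    which [x + alpha <= 0] ([sube_ksup]), so [r - r v] is again a point. *)

Set Implicit Arguments.
Unset Strict Implicit.
Unset Printing Implicit Defensive.
Import Order.TTheory GRing.Theory Num.Theory DualAddTheory.
Local Open Scope classical_set_scope.
Local Open Scope ereal_scope.

Section Scalars.
Variable K : scalars.
Implicit Types (x y : \bar K) (S : set (\bar K)).

Lemma ksup_eq S x : supremums S x -> ksup S = x.
Proof.
move=> [ubx lex]; have [ub le] := ksup_supremums S.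
by apply/eqP; rewrite eq_le le// lex.
Qed.

Lemma kinf_eq S x : infimums S x -> kinf S = x.
Proof.
move=> [lbx gex]; have [lb ge] := kinf_infimums S.
by apply/eqP; rewrite eq_le ge// gex.
Qed.

(** For finite [x] the shift by [- x] is the largest one on the right.  No
    shift is allowed for [x = +oo], which gives [-oo]; for [x = -oo] all shifts
    but [+oo] are, so that they push every [y] other than [-oo] up to [+oo]. *)
Lemma sube_ksup x y :
  y - x = ksup [set (y + alpha)%dE | alpha in [set alpha | (x + alpha)%dE <= 0]].
Proof.
apply/esym/ksup_eq; split=> [_ [alpha /= xa_le0 <-]|u ubu].
  move: xa_le0; rewrite !daddE_spec subE_spec.
  case: x => [r||]; case: y => [s||]; case: alpha => [t||];
    rewrite ?leey ?leNye ?lee_fin //.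
  by rewrite lerD2l -[(- r)%R]sub0r lerBrDl.
have le_u alpha : (x + alpha)%dE <= 0 -> (y + alpha)%dE <= u.
  by move=> xa_le0; apply: ubu; exists alpha.
case: x le_u {ubu} => [r||] le_u.
- have := le_u (- r)%:E; rewrite !daddE_spec subrr lexx subE_spec => /(_ isT).
  by case: y {le_u}.
- by rewrite subE_spec leNye.
- rewrite lee_subl_dadd daddE_spec.
  case: u le_u => [t||] le_u; [|exact: leey|].
  + case: y le_u => [s||] le_u //.
    (* The shift by [t - s + 1] carries [s] beyond the finite bound [t]. *)
    * have := le_u (t - s + 1)%:E; rewrite !daddE_spec leNye => /(_ isT).
      by rewrite lee_fin addrA subrKC gerDl ler10.
    * by have := le_u 0; rewrite !daddE_spec leNye => /(_ isT).
  + have := le_u 0; rewrite !daddE_spec leNye => /(_ isT).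
    by case: y {le_u}.
Qed.

End Scalars.

Section Points.
Variables (K : scalars) (D : lset K).
Implicit Types (p q r : ind D -> \bar K) (v w : ind D).

Lemma pts_ksup (I : Type) (P : set I) (F : I -> ind D -> \bar K) :
  (forall i, P i -> pts (F i)) -> pts (fun v => ksup [set F i v | i in P]).
Proof.
move=> PF; suff -> : (fun v => ksup [set F i v | i in P]) =
    (fun v => ksup [set p v | p in F @` P]).
  by apply: pts_sup => _ [i Pi <-]; exact: PF.
by apply/funext => v; rewrite image_comp.
Qed.

Lemma pts_kinf (I : Type) (P : set I) (F : I -> ind D -> \bar K) :
  (forall i, P i -> pts (F i)) -> pts (fun v => kinf [set F i v | i in P]).
Proof.
move=> PF; suff -> : (fun v => kinf [set F i v | i in P]) =
    (fun v => kinf [set p v | p in F @` P]).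
  by apply: pts_inf => _ [i Pi <-]; exact: PF.
by apply/funext => v; rewrite image_comp.
Qed.

Lemma pts_sub p x : pts p -> pts (fun v => p v - x).
Proof.
move=> Dp; under eq_fun do rewrite sube_ksup.
by apply: pts_ksup => alpha _; exact: pts_shift.
Qed.

Lemma pts_dist v : pts (fun w => dist (proj v) (proj w)).
Proof. by apply: pts_ksup => r Dr; exact: pts_sub. Qed.

(** An L-convex set contains every presheaf on its dual: Yoneda's formula
    writes [q w] as the infimum over [v] of [d(v, w) + q v], attained at
    [v = w] since [d(w, w) <= 0]. *)
Lemma pts_of_presheaf q :
  @presheaf_pts K (dual_cat D) (q \o @proj_inv K D) -> pts q.
Proof.
move=> q_nonexp.
suff -> : q = (fun w => kinf [set (dist (proj v) (proj w) + q v)%dE | v in setT]).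
  by apply: pts_kinf => v _; apply: pts_shift; exact: pts_dist.
apply/funext => w; apply/esym/kinf_eq; split=> [_ [v _ <-]|l lbl].
  by rewrite daddeC -lee_subl_dadd; exact: (q_nonexp (proj v) (proj w)).
apply: le_trans (lbl _ (ex_intro2 _ _ w I erefl)) _.
by rewrite -[leRHS]dadd0e; apply: dlee_add => //; exact: dist_self.
Qed.

End Points.

Section Inverses.
Variable K : scalars.

Lemma presheaf_representable (A : kcat K) (a : A) : presheaf_pts (dist a).
Proof. by move=> b c; rewrite /= lee_subl_dadd; exact: dist_triangle. Qed.

Lemma nonexpansive_of_precomp (A B : kcat K)
  (Phi : lhom (presheaf B) (presheaf A)) : @nonexpansive K A B (hom_ind Phi).
Proof.
move=> a a'; set f := hom_ind Phi.
have := hom_indP Phi (presheaf_representable (f a)) a a'.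
rewrite /= lee_subl_dadd => /le_trans; apply.
by rewrite -[leRHS]dadd0e; apply: dlee_add => //; exact: dist_self.
Qed.

Lemma dual_functor_pts (D E : lset K) (F : kfunctor (dual_cat E) (dual_cat D))
  (p : ind D -> \bar K) :
  pts p -> pts (p \o (@proj_inv K D \o F \o @proj K E)).
Proof.
move=> Dp; apply: pts_of_presheaf => X Y; apply: le_trans (fun_obP F X Y).
rewrite /= !proj_invK.
by apply: (ksup_supremums _).1; exists p.
Qed.

End Inverses.

Theorem theorem3p13 (K : scalars) (A B : kcat K) (D E : lset K) :
  bijective (@presheaf_map K A B
               : kfunctor A B -> lhom (presheaf B) (presheaf A))
  /\ bijective (@dual_map K D E
               : lhom D E -> kfunctor (dual_cat E) (dual_cat D)).
Proof.
split.
  exists (fun Phi => KFunctor (@nonexpansive_of_precomp K A B Phi)).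
    by move=> F; exact: kfunctor_eq.
  by move=> Phi; exact: lhom_eq.
exists (fun F => LHom (@dual_functor_pts K D E F)).
  by move=> Phi; exact: lhom_eq.
move=> F; apply: kfunctor_eq; apply/funext => X.
by rewrite /= /dual_map_ob /= !proj_invK.
Qed.
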